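(* Let $u,v\in S_n$. The restriction at $v$ of the equivariant Schubert class $\tau_u$ of $SL_n(\mathbb{C})/B$ is given by $$\tau_u(v)=\sum_{\gamma\in C_0(u,v)}E(\gamma)=\sum_{\gamma\in C_0(u,v)}\ \prod_{(a,b)\in\mathrm{Inv}(v,\gamma)}(x_a-x_b).$$
   Context: $G=SL_n(\mathbb{C})$, $B$ is the subgroup of upper triangular matrices, $M=G/B$ is the manifold of complete flags in $\mathbb{C}^n$, $T$ is the compact diagonal torus acting by left multiplication, and $M^T$ is identified with $W=S_n$. The simple roots are $\alpha_i=x_i-x_{i+1}$ ($1\leq i\leq n-1$), the positive roots are $x_i-x_j$ for $1\leq i<j\leq n$, and $S_n$ acts by permuting the variables, $w\cdot x_i=x_{w(i)}$. $(i,j)$ denotes the transposition swapping $i$ and $j$, which is the reflection for $x_i-x_j$; $\ell$ is the length (number of inversions). The restriction $H_T^*(M;\mathbb{Q})\to\mathrm{Maps}(S_n,\mathbb{Q}[\alpha_1,\dots,\alpha_{n-1}])$ to fixed points is injective. The equivariant Schubert class $\tau_u$ is the class induced by $\overline{B_-uB}/B$ ($B_-$ = opposite Borel), and $\tau_u(v)$ is its restriction to the fixed point $v$. Equivalently, $\tau_u$ is the unique map $S_n\to\mathbb{S}=\mathbb{Q}[\alpha_1,\dots,\alpha_{n-1}]$ such that: $\tau_u(p(i,j))-\tau_u(p)\in(x_{p(i)}-x_{p(j)})\mathbb{S}$ for all $p\in S_n$, $i<j$; each $\tau_u(p)$ is homogeneous of degree $\ell(u)$; $\tau_u(p)=0$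 unless $u\preccurlyeq p$ in the strong Bruhat order; and $\tau_u(u)=\prod_{(a,b)\in\mathrm{Inv}(u)}(x_a-x_b)$. Inversions as values: $\mathrm{Inv}(v)=\{(v(j),v(i)) : i<j,\ v(i)>v(j)\}$. $C_0(u,v)$ is the set of ascending chains of maximal length $$\gamma:\ u=u_0\xrightarrow{*(i_1,j_1)}u_1\xrightarrow{*(i_2,j_2)}\cdots\xrightarrow{*(i_m,j_m)}u_m=v$$ (that is, $u_k=u_{k-1}(i_k,j_k)$ with $i_k<j_k$, $u_{k-1}(i_k)<u_{k-1}(j_k)$, and $\ell(u_k)=\ell(u_{k-1})+1$ for all $k$) such that $i_1\leq i_2\leq\dots\leq i_m$. For such a chain, $$\mathrm{Inv}(v,\gamma)=\mathrm{Inv}(v)\setminus\{(u_{k-1}(i_k),v(i_k)) : k=1,\dots,m\},\qquad E(\gamma)=\prod_{(a,b)\in\mathrm{Inv}(v,\gamma)}(x_a-x_b).$$ *)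

(* Defs.v *)
From mathcomp Require Import all_boot all_order all_fingroup all_algebra.
From mathcomp Require Export mpoly.

Set Implicit Arguments.
Unset Strict Implicit.
Unset Printing Implicit Defensive.

Import GRing.Theory.
Local Open Scope ring_scope.

(* Indices and values are 0-based: 'S_n permutes {0, ..., n-1}, and the
   variable x_(a+1) is 'X_a with a : 'I_n. *)

Definition xdiff (n : nat) (a b : 'I_n) : {mpoly rat[n]} := 'X_a - 'X_b.

(* For k : 'I_n.-1, [ordS] computes k.+1 %% n, which is k.+1 since k.+1 < n:
   the cyclic wrap-around never happens here. *)
Definition simple_root (n : nat) (k : 'I_n.-1) : {mpoly rat[n]} :=
  let i := widen_ord (leq_pred n) k in xdiff i (ordS i).

(* The subring Q[alpha_1, ..., alpha_(n-1)] of Q[x_1, ..., x_n]: the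
   polynomial expressions in the simple roots. *)
Definition in_root_ring (n : nat) (f : {mpoly rat[n]}) : Prop :=
  exists q : {mpoly rat[n.-1]},
    f = q \mPo [tuple @simple_root n k | k < n.-1].

(* The product (i, j) first, then p, i.e. the composite p o (i, j); products
   in 'S_n are read from left to right. *)
Definition rmul_tperm (n : nat) (p : 'S_n) (ij : 'I_n * 'I_n) : 'S_n :=
  (tperm ij.1 ij.2 * p)%g.

(* Inversions as pairs of values: the smaller value comes first. *)
Definition Inv (n : nat) (v : 'S_n) : {set 'I_n * 'I_n} :=
  [set (v ij.2, v ij.1) | ij : 'I_n * 'I_n & (ij.1 < ij.2)%N && (v ij.2 < v ij.1)%N].

Definition plength (n : nat) (v : 'S_n) : nat := #|Inv v|.

Definition bruhat_step (n : nat) : rel 'S_n :=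
  fun p q => [exists ij : 'I_n * 'I_n,
    (q == rmul_tperm p ij) && (plength p < plength q)%N].

Definition bruhat (n : nat) (p q : 'S_n) : bool := connect (@bruhat_step n) p q.

(* The fixed-point restrictions of the equivariant Schubert class of u:
   [tau p] is the restriction at the fixed point p of SL_n(C)/B. *)
Record equivariant_schubert_class (n : nat) (u : 'S_n)
    (tau : 'S_n -> {mpoly rat[n]}) : Prop := EquivariantSchubertClass {
  schubert_root_ring : forall p, in_root_ring (tau p);
  schubert_gkm : forall (p : 'S_n) (i j : 'I_n), (i < j)%N ->
    exists2 f, in_root_ring f
      & tau (rmul_tperm p (i, j)) - tau p = xdiff (p i) (p j) * f;
  schubert_homog : forall p, tau p \is (plength u).-homog;
  schubert_support : forall p, ~~ bruhat u p -> tau p = 0;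
  schubert_diag : tau u = \prod_(ab in Inv u) xdiff ab.1 ab.2
}.

(* A chain from u is given by its sequence of labels (i_1, j_1), ...,
   (i_m, j_m), which determines its vertices; [chain_vertex u s k] is u_k. *)
Definition chain_vertex (n : nat) (u : 'S_n) (s : seq ('I_n * 'I_n)) (k : nat) :
    'S_n :=
  foldl (@rmul_tperm n) u (take k s).

(* Each step raises the length by one, so that a chain from u to v has exactly
   plength v - plength u steps. If plength v < plength u, the truncated
   subtraction leaves only the empty chain, which does not end at v. *)
Definition nsteps (n : nat) (u v : 'S_n) : nat := (plength v - plength u)%N.

(* The label of step k.+1 is [tnth g k], as tuples are indexed from 0. *)
Definition C0 (n : nat) (u v : 'S_n) :
    {set (nsteps u v).-tuple ('I_n * 'I_n)} :=
  [set g : (nsteps u v).-tuple ('I_n * 'I_n) |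
    [&& [forall k : 'I_(nsteps u v),
           let p := chain_vertex u g k in
           let: (i, j) := tnth g k in
           [&& (i < j)%N, (p i < p j)%N
             & plength (chain_vertex u g k.+1) == (plength p).+1]],
        chain_vertex u g (nsteps u v) == v
      & sorted leq [seq val ij.1 | ij : 'I_n * 'I_n <- g]]].

Definition Inv_chain (n : nat) (u v : 'S_n)
    (g : (nsteps u v).-tuple ('I_n * 'I_n)) : {set 'I_n * 'I_n} :=
  Inv v :\: [set (chain_vertex u g k (tnth g k).1, v (tnth g k).1)
            | k : 'I_(nsteps u v)].

Definition E (n : nat) (u v : 'S_n)
    (g : (nsteps u v).-tuple ('I_n * 'I_n)) : {mpoly rat[n]} :=
  \prod_(ab in Inv_chain g) xdiff ab.1 ab.2.

(* Main.v *)
From HB Require Import structures.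
Require Import Defs.
From mathcomp Require Import all_boot all_order all_fingroup all_algebra.
From mathcomp Require Import mpoly.
From mathcomp Require Import zify ring.

(** Fix fixed-point classes tau_w for all w. The formula follows from one recursion.
    Let k be the first position where u and v differ. Then

      (x_(u k) - x_(v k)) tau_u(v) = sum of tau_(u(k,j))(v),

    over the j > k such that u(k,j) covers u ([first_difference_recursion]). Since
    the factor on the left is not zero, this determines tau_u(v) from longer
    elements, down to the known value tau_v(v).

    The recursion is the equivariant Chevalley formula ([chevalley]) for the weight
    x_(p 0) + ... + x_(p k), evaluated at v. It has one term for each cover u(i,j)
    with i <= k < j. When i < k, the element u(i,j) exceeds v at their first
    difference i, so it is not below v and its term vanishes. The Chevalley formula
    itself is a uniqueness statement: a map that satisfies the congruences, has
    degree at most d, and vanishes at all elements of length at most d is zero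
    ([gkm_vanish]), because its value at an element p of minimal length in its
    support is divisible by the l(p) > d pairwise coprime factors of Inv(p). One
    compares the two sides at elements of length at most l(u) + 1, where only the
    values of tau_u at covers of u are not immediate ([schubert_cover]).

    The Chevalley formula involves the classes of the covers of u, whereas only one
    class is given. All of them are constructed here, downwards from the longest
    element, by divided differences ([schubert_exists]); the given class equals the
    constructed one by uniqueness.

    The sum over chains satisfies the same recursion ([chain_sumS]). A label (i, j)
    raises the value at i, and no later label of a chain with increasing labels
    lowers it again. Hence a chain cannot use a label i < k, and it must start with
    i = k in order to change the value at k. Removing that first step restores
    exactly the factor x_(u k) - x_(v k) of the product E. *)

Set Implicit Arguments.
Unset Strict Implicit.
Unset Printing Implicit Defensive.

Import GRing.Theory.
Local Open Scope ring_scope.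

(** * Divisibility by differences of variables *)

Section Specialization.
Variable n : nat.
Implicit Types (f g : {mpoly rat[n]}) (a b c d : 'I_n) (S : {set 'I_n * 'I_n}).

(** The substitution x_a := x_b is a ring morphism whose kernel is generated by
    x_a - x_b, so that divisibility by x_a - x_b becomes the vanishing of a
    specialization, and the primality of x_a - x_b comes for free. *)
Definition identify a b f : {mpoly rat[n]} :=
  f \mPo [tuple 'X_(if i == a then b else i) | i < n].

HB.instance Definition _ a b :=
  GRing.RMorphism.copy (identify a b)
    (comp_mpoly [tuple 'X_(if i == a then b else i) | i < n]).

Lemma identifyX a b c : identify a b 'X_c = 'X_(if c == a then b else c).
Proof. by rewrite /identify comp_mpolyXU -tnth_nth tnth_mktuple. Qed.

Lemma identify_xdiff a b c d :
  identify a b (xdiff c d)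
  = xdiff (if c == a then b else c) (if d == a then b else d).
Proof. by rewrite /xdiff rmorphB /= !identifyX. Qed.

Lemma xdiffxx a : xdiff a a = 0.
Proof. exact: subrr. Qed.

Lemma xdiffC a b : xdiff b a = - xdiff a b.
Proof. by rewrite /xdiff opprB. Qed.

Lemma xdiff_eq0 a b : (xdiff a b == 0) = (a == b).
Proof.
apply/idP/eqP => [|->]; last by rewrite xdiffxx.
rewrite /xdiff subr_eq0 => /eqP/(congr1 (mcoeff U_(a))).
rewrite !mcoeffXU eqxx; by case: eqVneq => // _ /eqP; rewrite oner_eq0.
Qed.

Lemma identify_xdiff_self a b : identify a b (xdiff a b) = 0.
Proof. by rewrite identify_xdiff eqxx; case: ifP => _; rewrite xdiffxx. Qed.

Lemma identify_tperm a b c : identify a b 'X_(tperm a b c) = identify a b 'X_c.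
Proof.
rewrite !identifyX; congr 'X_ _.
by case: tpermP => [->|->|/eqP/negPf-> //]; rewrite ?eqxx; case: eqP.
Qed.

Lemma identify_xdiff_tperm a b c d :
  identify a b (xdiff (tperm a b c) (tperm a b d)) = identify a b (xdiff c d).
Proof. by rewrite /xdiff !rmorphB /= !identify_tperm. Qed.

Lemma identify_mod a b f : exists g, f = identify a b f + xdiff a b * g.
Proof.
pose P f := exists g, f = identify a b f + xdiff a b * g.
have P1 : P 1 by exists 0; rewrite rmorph1 mulr0 addr0.
have PM p q : P p -> P q -> P (p * q).
  move=> [g eg] [h eh]; exists (g * q + identify a b p * h).
  by rewrite rmorphM /= {1}eg mulrDl -!mulrA {1}eh; ring.
elim/mpolyind: f => [|c m f _ _ [g ef]]; first by exists 0; rewrite rmorph0 mulr0 addr0.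
suff [h eh] : P 'X_[m].
  exists (c *: h + g); rewrite rmorphD /= {1}ef {1}eh.
  have -> : identify a b (c *: 'X_[m]) = c *: identify a b 'X_[m].
    by rewrite /identify linearZ.
  by rewrite scalerDr scalerAr mulrDr -!addrA; congr (_ + _); rewrite addrCA.
rewrite mpolyXE_id; elim/big_rec: _ => [//|i q _]; apply: (PM).
elim: (m i) => [//|k IHk]; rewrite exprS; apply: (PM) => //.
rewrite /P identifyX; case: eqP => [->|_]; last by exists 0; rewrite mulr0 addr0.
by exists 1; rewrite /xdiff mulr1 addrC subrK.
Qed.

Lemma identify_eq0 a b f : identify a b f = 0 <-> exists g, f = xdiff a b * g.
Proof.
split=> [f0|[g ->]]; last by rewrite rmorphM /= identify_xdiff_self mul0r.
by have [g eg] := identify_mod a b f; exists g; rewrite eg f0 add0r.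
Qed.

Lemma identifyC a b f : identify a b f = 0 -> identify b a f = 0.
Proof.
by move=> /identify_eq0[g ->]; apply/identify_eq0; exists (- g); rewrite xdiffC; ring.
Qed.

Lemma identify_xdiff_neq0 a b c d : (a < b)%N -> (c < d)%N ->
  (c, d) != (a, b) -> identify a b (xdiff c d) != 0.
Proof.
move=> ab cd; rewrite identify_xdiff xdiff_eq0 xpair_eqE -!val_eqE /=.
by do 2 case: ifP => /= /eqP ?; lia.
Qed.

(** Distinct differences x_a - x_b are pairwise coprime, hence the product of
    those dividing [f] still divides [f]. *)
Lemma prod_xdiff_dvd S f :
    (forall ab, ab \in S -> (ab.1 < ab.2)%N) ->
    (forall ab, ab \in S -> identify ab.1 ab.2 f = 0) ->
  exists g, f = (\prod_(ab in S) xdiff ab.1 ab.2) * g.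
Proof.
move=> Slt S0.
suff [g ->] : exists g, f = (\prod_(ab <- enum S) xdiff ab.1 ab.2) * g.
  by exists g; rewrite big_enum.
have /allP : all (mem S) (enum S) by apply/allP => x; rewrite mem_enum.
have := enum_uniq (mem S); elim: (enum S) => [|[a b] s IHs] /=.
  by exists f; rewrite big_nil mul1r.
case/andP=> abs us sS.
have [|g eg] := IHs us; first by move=> x xs; apply: sS; rewrite inE xs orbT.
have abS : (a, b) \in S by apply: sS; rewrite inE eqxx.
have : identify a b f = 0 by exact: (S0 _ abS).
rewrite eg rmorphM /= => /eqP; rewrite mulf_eq0 => /orP[|/eqP/identify_eq0[h ->]].
  rewrite rmorph_prod prodf_seq_eq0 => /hasP[[c d] cds /= /negPn/negP[]].
  apply: identify_xdiff_neq0 (Slt _ abS) _ _; last by apply: contraNneq abs => <-.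
  by apply: (Slt (c, d)); apply: sS; rewrite inE cds orbT.
by exists h; rewrite big_cons mulrCA mulrA.
Qed.

Lemma msize_xdiff a b : a != b -> msize (xdiff a b) = 2.
Proof.
move=> ab; apply/eqP; rewrite eqn_leq; apply/andP; split.
  by rewrite (leq_trans (msizeD_le _ _)) // msizeN !msizeX !mdeg1 maxnn.
suff: U_(a)%MM \in msupp (xdiff a b) by move/msize_mdeg_lt; rewrite mdeg1.
by rewrite mcoeff_msupp mcoeffB !mcoeffXU eqxx [b == a]eq_sym (negPf ab) subr0 oner_eq0.
Qed.

Lemma prod_xdiff_neq0 S : (forall ab, ab \in S -> (ab.1 < ab.2)%N) ->
  \prod_(ab in S) xdiff ab.1 ab.2 != 0.
Proof.
move=> Slt; apply/prodf_neq0 => ab /Slt lt_ab.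
by rewrite xdiff_eq0 -val_eqE neq_ltn lt_ab.
Qed.

Lemma msize_prod_xdiff S : (forall ab, ab \in S -> (ab.1 < ab.2)%N) ->
  msize (\prod_(ab in S) xdiff ab.1 ab.2) = #|S|.+1.
Proof.
move=> Slt; rewrite -big_enum cardE.
have /allP : all (mem S) (enum S) by apply/allP => x; rewrite mem_enum.
elim: (enum S) => [|x s IHs] sS /=; first by rewrite big_nil msize1.
have sS' y : y \in s -> y \in S by move=> ys; apply: sS; rewrite inE ys orbT.
have x12 : x.1 != x.2.
  by have := Slt x (sS _ (mem_head _ _)); rewrite -val_eqE neq_ltn => ->.
rewrite big_cons msizeM ?IHs ?msize_xdiff ?xdiff_eq0 //.
apply/negP; rewrite prodf_seq_eq0 => /hasP[y /sS' /Slt lt_y /=].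
by rewrite xdiff_eq0 -val_eqE ltn_eqF.
Qed.

(** A polynomial with too many coprime linear factors for its degree vanishes. *)
Lemma prod_xdiff_dvd_eq0 S f :
    (forall ab, ab \in S -> (ab.1 < ab.2)%N) ->
    (forall ab, ab \in S -> identify ab.1 ab.2 f = 0) ->
  (msize f <= #|S|)%N -> f = 0.
Proof.
move=> Slt S0; have [g ->] := prod_xdiff_dvd Slt S0.
case: (eqVneq g 0) => [->|g0]; first by rewrite mulr0.
rewrite msizeM ?prod_xdiff_neq0 // msize_prod_xdiff //.
by rewrite addSn -[leqRHS]addn0 leq_add2l leqn0 msize_poly_eq0 (negPf g0).
Qed.

End Specialization.


(** * Inversions and reflections *)

Section Inversions.
Variable n : nat.
Implicit Types (u v p : 'S_n) (i j k a b c d : 'I_n).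

Lemma rmul_tpermE u ij k : rmul_tperm u ij k = u (tperm ij.1 ij.2 k).
Proof. by rewrite /rmul_tperm permM. Qed.

Lemma rmul_tpermK u ij : rmul_tperm (rmul_tperm u ij) ij = u.
Proof. by apply/permP => k; rewrite !rmul_tpermE tpermK. Qed.

Lemma mem_Inv v c d :
  ((c, d) \in Inv v) = (c < d)%N && ((v^-1)%g d < (v^-1)%g c)%N.
Proof.
apply/imsetP/andP => [[[i j]] /=|[cd dc]].
  by rewrite inE /= => /andP[ij ji] [-> ->]; rewrite !permK.
by exists ((v^-1)%g d, (v^-1)%g c); rewrite ?inE /= !permKV ?dc.
Qed.

Lemma Inv_lt v ab : ab \in Inv v -> (ab.1 < ab.2)%N.
Proof. by case: ab => a b; rewrite mem_Inv => /andP[]. Qed.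

Lemma rmul_tpermV u i j c :
  ((rmul_tperm u (i, j))^-1)%g c = tperm i j ((u^-1)%g c).
Proof. by rewrite /rmul_tperm invMg permM tpermV. Qed.

Lemma rmul_tpermV_val u i j c :
  ((rmul_tperm u (i, j))^-1)%g c = (u^-1)%g (tperm (u i) (u j) c).
Proof.
by rewrite rmul_tpermV (inj_tperm _ _ _ (@perm_inj _ (u^-1)%g)) !permK.
Qed.

(** An adjacent transposition changes the relative position of one pair of values
    only. *)
Lemma Inv_adjacent u i j : j = i.+1 :> nat -> (u i < u j)%N ->
  Inv (rmul_tperm u (i, j)) = (u i, u j) |: Inv u.
Proof.
move=> ij lt_u; apply/setP => [[c d]]; rewrite !inE !mem_Inv !rmul_tpermV xpair_eqE.
rewrite -[c](permKV u) -[d](permKV u) !permK.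
set x := (u^-1)%g c; set y := (u^-1)%g d.
rewrite !(inj_eq perm_inj).
case: tpermP => [->|->|/eqP yi /eqP yj]; case: tpermP => [->|->|/eqP xi /eqP xj];
  rewrite ?eqxx -?val_eqE /=; try move: yi yj; try move: xi xj;
  by rewrite -?val_eqE /= ?ltnn ?andbT; lia.
Qed.

Section Reflection.
Variables (u : 'S_n) (i j : 'I_n).
Hypotheses (ij : (i < j)%N) (lt_u : (u i < u j)%N).
Let p := rmul_tperm u (i, j).
Let s := tperm (u i) (u j).

(** An injection of the inversions of [u] into those of [p] other than the reflected
    pair, changing an inversion only when the reflection destroys it. It gives both
    the growth of the length and, in a cover, the comparison of the two products. *)
Definition lift_Inv (cd : 'I_n * 'I_n) : 'I_n * 'I_n :=
  if cd \in Inv p then cd else (s cd.1, s cd.2).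

Lemma reflection_in_Inv : (u i, u j) \in Inv p.
Proof. by rewrite mem_Inv lt_u !rmul_tpermV !permK tpermL tpermR ij. Qed.

(** If an inversion c < d of [u] is lost in [p], then exactly one of c, d lies in
    {u i, u j}, and exchanging u i and u j in it gives an inversion of [p]. *)
Lemma lift_Inv_in cd : cd \in Inv u -> lift_Inv cd \in Inv p :\ (u i, u j).
Proof.
case: cd => c d; rewrite mem_Inv => /andP[cd dc]; rewrite inE /lift_Inv.
case: ifP => [->|].
  rewrite inE andbT xpair_eqE; apply/negP => /andP[/eqP ec /eqP ed].
  by move: dc; rewrite ec ed !permK; lia.
rewrite !mem_Inv !rmul_tpermV_val -/s cd /= !tpermK dc !inE xpair_eqE andbT.
have : ((u^-1)%g (u i) < (u^-1)%g (u j))%N by rewrite !permK.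
move: (u^-1)%g lt_u dc; rewrite /s; move: (u i) (u j) => a b pos ab dc pab.
case: (tpermP a b d) => [ed|ed|/eqP da /eqP db];
  case: (tpermP a b c) => [ec|ec|/eqP ca /eqP cb]; subst;
  try move: da db; try move: ca cb; rewrite ?eqxx -?val_eqE /=; lia.
Qed.

Lemma lift_Inv_inj : {in Inv u &, injective lift_Inv}.
Proof.
(* A moved inversion of [u] lands on a pair that is not an inversion of [u], so it
   cannot meet a fixed one. *)
have fixed_moved (x y : 'I_n * 'I_n) : x \in Inv u -> y \in Inv u ->
    y \notin Inv p -> x = (s y.1, s y.2) -> False.
  case: x y => [x1 x2] [y1 y2] + + + [ex1 ex2].
  rewrite !mem_Inv !rmul_tpermV_val -/s ex1 ex2 => /andP[_ ->] /andP[-> _].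
  by [].
move=> x y xu yu; rewrite /lift_Inv.
case: ifPn => xp; case: ifPn => yp // exy.
- by case: (fixed_moved x y).
- by case: (fixed_moved y x).
by case: x y exy {xu yu xp yp} => [x1 x2] [y1 y2] [/perm_inj-> /perm_inj->].
Qed.

Lemma plength_rmul_lt : (plength u < plength p)%N.
Proof.
rewrite /plength (cardsD1 (u i, u j) (Inv p)) reflection_in_Inv ltnS.
rewrite -(card_in_imset lift_Inv_inj); apply/subset_leq_card/subsetP => x.
by case/imsetP => y yu ->; exact: lift_Inv_in.
Qed.

(** In a cover the map [lift_Inv] is onto, and it only exchanges u i and u j. *)
Lemma cover_prod_Inv : plength p = (plength u).+1 ->
  identify (u i) (u j) (\prod_(ab in Inv p :\ (u i, u j)) xdiff ab.1 ab.2)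
  = identify (u i) (u j) (\prod_(ab in Inv u) xdiff ab.1 ab.2).
Proof.
move=> cov; have <- : lift_Inv @: Inv u = Inv p :\ (u i, u j).
  apply/eqP; rewrite eqEcard; apply/andP; split.
    by apply/subsetP => x /imsetP[y yu ->]; exact: lift_Inv_in.
  rewrite (card_in_imset lift_Inv_inj) -ltnS -/(plength u) -cov /plength.
  by rewrite (cardsD1 (u i, u j) (Inv p)) reflection_in_Inv.
rewrite (big_imset _ lift_Inv_inj) !rmorph_prod; apply: eq_bigr => -[c d] _.
by rewrite /lift_Inv; case: ifP => // _; exact: identify_xdiff_tperm.
Qed.

End Reflection.

Lemma plength_rmul_gt u i j : (i < j)%N -> (u j < u i)%N ->
  (plength (rmul_tperm u (i, j)) < plength u)%N.
Proof.
move=> ij lt_u; rewrite -{2}[u](rmul_tpermK u (i, j)); apply: plength_rmul_lt => //.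
by rewrite !rmul_tpermE /= tpermL tpermR.
Qed.

Lemma cover_lt u i j : (i < j)%N ->
  plength (rmul_tperm u (i, j)) = (plength u).+1 -> (u i < u j)%N.
Proof.
move=> ij cov; rewrite ltnNge; apply/negP; rewrite leq_eqVlt.
case/orP => [/eqP/val_inj/perm_inj e|lt_u]; first by move: ij; rewrite e ltnn.
by have := plength_rmul_gt ij lt_u; rewrite cov; lia.
Qed.

Lemma plength_adjacent u i j : j = i.+1 :> nat -> (u i < u j)%N ->
  plength (rmul_tperm u (i, j)) = (plength u).+1.
Proof.
by move=> ij lt_u; rewrite /plength Inv_adjacent // cardsU1 mem_Inv !permK; lia.
Qed.

Lemma plength_adjacent_le u i j : j = i.+1 :> nat ->
  (plength (rmul_tperm u (i, j)) <= (plength u).+1)%N.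
Proof.
move=> ij; case: (ltngtP (u i) (u j)) => [lt_u|lt_u|/val_inj/perm_inj eij].
- by rewrite plength_adjacent.
- by apply/ltnW/ltnW; rewrite ltnS; apply: plength_rmul_gt => //; rewrite ij.
by move: ij; rewrite eij; lia.
Qed.

End Inversions.

(** * Rank domination *)

Section Domination.
Variable n : nat.
Implicit Types (u v p w : 'S_n) (i j : 'I_n) (k a : nat).

Definition rank u k a : nat := \sum_(i < n | (i < k)%N) (a <= u i)%N.

(** The rank form of the Bruhat order. It is used instead of [bruhat] because it
    is inherited along divided differences and compares values directly. *)
Definition dominated u p := forall k a, (rank u k a <= rank p k a)%N.

Lemma rankS u j a : rank u j.+1 a = (rank u j a + (a <= u j))%N.
Proof.
rewrite /rank (bigD1 j) //= addnC; congr (_ + _)%N; apply: eq_bigl => i.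
by rewrite ltnS -val_eqE /=; lia.
Qed.

Lemma rank_rmul_adjacent u i j k a : j = i.+1 :> nat -> k != j ->
  rank (rmul_tperm u (i, j)) k a = rank u k a.
Proof.
move=> ij kj; rewrite /rank [RHS](reindex_inj (@perm_inj _ (tperm i j))) /=.
apply: eq_big => [m|m _]; last by rewrite rmul_tpermE.
by case: tpermP => [->|->|//]; move: ij kj; lia.
Qed.

(** At an ascent i of [u], the rank condition for k = i + 1 follows from its two
    neighbours, so it can be dropped. *)
Lemma dominated_ascent u p i j : j = i.+1 :> nat -> (u i < u j)%N ->
  (forall k a, k != j -> (rank u k a <= rank p k a)%N) -> dominated u p.
Proof.
move=> ij lt_u dom k a; case: (eqVneq k j) => [->|]; last exact: dom.
have := dom i a; have := dom j.+1 a; rewrite !rankS ij !rankS.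
have := leq_b1 (a <= p j)%N.
case: (leqP a (u i)) => aui; case: (leqP a (u j)) => auj; lia.
Qed.

Lemma dominated_rmul u p i j : j = i.+1 :> nat -> (u i < u j)%N ->
  dominated (rmul_tperm u (i, j)) p -> dominated u p.
Proof.
move=> ij lt_u dom; apply: (dominated_ascent ij lt_u) => k a kj.
by rewrite -(rank_rmul_adjacent u a ij kj).
Qed.

Lemma dominated_rmul2 u p i j : j = i.+1 :> nat -> (u i < u j)%N ->
  dominated (rmul_tperm u (i, j)) (rmul_tperm p (i, j)) -> dominated u p.
Proof.
move=> ij lt_u dom; apply: (dominated_ascent ij lt_u) => k a kj.
by rewrite -(rank_rmul_adjacent u a ij kj) -(rank_rmul_adjacent p a ij kj).
Qed.

(** With threshold u i, the ranks agree up to position i, so the next term decides. *)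
Lemma dominated_first_diff u p i : dominated u p ->
  (forall m : 'I_n, (m < i)%N -> u m = p m) -> (u i <= p i)%N.
Proof.
move=> dom eq_up; have := dom i.+1 (u i); rewrite !rankS leqnn.
have -> : rank u i (u i) = rank p i (u i).
  by rewrite /rank; apply: eq_bigr => m mi; rewrite (eq_up m mi).
by case: leqP => //; lia.
Qed.

End Domination.

(** * Fixed-point classes *)

Section Classes.
Variable n : nat.
Implicit Types (u v p w : 'S_n) (i j : 'I_n).
Implicit Types (f g : 'S_n -> {mpoly rat[n]}).

Definition gkm f := forall p i j, (i < j)%N ->
  identify (p i) (p j) (f (rmul_tperm p (i, j))) = identify (p i) (p j) (f p).

Lemma gkm_Inv f p a b : gkm f -> (a, b) \in Inv p ->
  f (rmul_tperm p ((p^-1)%g b, (p^-1)%g a)) = 0 -> identify a b (f p) = 0.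
Proof.
move=> gf; rewrite mem_Inv => /andP[ab ba] f0; apply: identifyC.
by have := gf p _ _ ba; rewrite !permKV f0 rmorph0.
Qed.

Lemma plength_rmul_Inv p a b : (a, b) \in Inv p ->
  (plength (rmul_tperm p ((p^-1)%g b, (p^-1)%g a)) < plength p)%N.
Proof.
by rewrite mem_Inv => /andP[ab ba]; apply: plength_rmul_gt => //; rewrite !permKV.
Qed.

(** At a point [p] of minimal length where [f] does not vanish, [f p] is divisible
    by the product over the inversions of [p], whose degree is too large. *)
Lemma gkm_vanish f d : gkm f -> (forall p, msize (f p) <= d.+1)%N ->
  (forall p, (plength p <= d)%N -> f p = 0) -> forall p, f p = 0.
Proof.
move=> gf szf f0 p; have [m] := ubnP (plength p).
elim: m p => // m IHm p; rewrite ltnS => pm.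
have [/f0 //|pd] := leqP (plength p) d.
apply: (@prod_xdiff_dvd_eq0 _ (Inv p)) => [ab|[a b] abI|]; first exact: Inv_lt.
  by apply: gkm_Inv => //; apply: IHm; apply: leq_trans (plength_rmul_Inv abI) pm.
exact: leq_trans (szf p) pd.
Qed.

(** The properties of the class of [u] that determine it and that are inherited
    along divided differences. *)
Record schubert u f : Prop := Schubert {
  schubert_is_gkm : gkm f;
  schubert_msize : forall p, (msize (f p) <= (plength u).+1)%N;
  schubert_small : forall p, (plength p <= plength u)%N -> p != u -> f p = 0;
  schubert_self : f u = \prod_(ab in Inv u) xdiff ab.1 ab.2;
  schubert_dominated : forall p, f p != 0 -> dominated u p
}.

(** * Existence by divided differences *)

Lemma rmul_tperm_comm p i j k l :
  rmul_tperm (rmul_tperm p (k, l)) (i, j)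
  = rmul_tperm (rmul_tperm p (i, j)) (tperm i j k, tperm i j l).
Proof.
apply/permP => m; rewrite !rmul_tpermE /=; congr (p _).
by rewrite (inj_tperm _ _ _ (@perm_inj _ (tperm i j))) !tpermK.
Qed.

(** The congruence of [g] modulo x_(p k) - x_(p l) follows from that of [f] after
    cancelling x_(p i) - x_(p j), which is prime to the modulus. When (k, l) = (i, j)
    cancellation fails, but then [g] takes equal values at the two points. *)
Lemma gkm_divided_difference f g i j : j = i.+1 :> nat -> gkm f ->
  (forall p, f (rmul_tperm p (i, j)) - f p = xdiff (p i) (p j) * g p) -> gkm g.
Proof.
move=> ij gf fg p k l kl; set q := rmul_tperm p (k, l).
have ne_ij : i != j by rewrite -val_eqE /= ij neq_ltn ltnSn.
case: (eqVneq (k, l) (i, j)) => [[ek el]|kl_ij].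
  have := fg q; rewrite /q ek el rmul_tpermK !rmul_tpermE /= tpermL tpermR => fq.
  have /mulfI inj : xdiff (p i) (p j) != 0 by rewrite xdiff_eq0 (inj_eq perm_inj).
  by congr identify; apply: inj; rewrite -fg -[LHS]opprK -mulNr -xdiffC -fq opprB.
have skl : (tperm i j k < tperm i j l)%N.
  move: kl_ij; rewrite xpair_eqE.
  case: (tpermP i j k) => [ek|ek|/eqP ki /eqP kj];
    case: (tpermP i j l) => [el|el|/eqP li /eqP lj]; rewrite ?ek ?el in kl *;
    try move: ki kj; try move: li lj; rewrite ?eqxx -?val_eqE /=; lia.
have := congr1 (identify (p k) (p l)) (fg q).
rewrite rmorphB /= rmul_tperm_comm.
have := gf (rmul_tperm p (i, j)) _ _ skl.
rewrite !rmul_tpermE /= !tpermK => ->; rewrite (gf p k l kl) -rmorphB /= fg.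
rewrite !rmorphM /= !(inj_tperm _ _ _ (@perm_inj _ p)).
rewrite identify_xdiff_tperm => /mulfI-> //.
rewrite identify_xdiff xdiff_eq0 !(inj_eq perm_inj).
move: kl_ij; rewrite xpair_eqE.
case: (eqVneq i k) => [ei|ik]; case: (eqVneq j k) => [ej|jk];
  rewrite !(inj_eq perm_inj) // ?ei -?val_eqE /=; move: ij kl; rewrite ?ei ?ej; lia.
Qed.

(** The value of [g] at [p] involves only those of [f] at [p] and at the adjacent
    element, so the vanishing conditions pass from w to u because the two elements
    differ in length by one. At [u] itself, f u = 0 and the divisor removes the one
    inversion that w has and u has not. *)
Lemma schubert_divided_difference u f i j : j = i.+1 :> nat -> (u i < u j)%N ->
  schubert (rmul_tperm u (i, j)) f -> exists g, schubert u g.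
Proof.
move=> ij lt_u; set w := rmul_tperm u (i, j) => sf.
have lw : plength w = (plength u).+1 by exact: plength_adjacent.
have lt_ij : (i < j)%N by rewrite ij.
have ne_ij p : p i != p j by rewrite (inj_eq perm_inj) -val_eqE /= ij neq_ltn ltnSn.
have dvd_f p : exists h, f (rmul_tperm p (i, j)) - f p = xdiff (p i) (p j) * h.
  by apply/identify_eq0; rewrite rmorphB /= (schubert_is_gkm sf) // subrr.
have [g fg] := fin_all_exists dvd_f.
have g_f p : g p != 0 -> (f p != 0) || (f (rmul_tperm p (i, j)) != 0).
  move=> gp; have := mulf_neq0 (_ : xdiff (p i) (p j) != 0) gp.
  rewrite xdiff_eq0 ne_ij -fg => /(_ isT).
  by case: (eqVneq (f p) 0) => // ->; rewrite subr0.
exists g; split.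
- exact: (gkm_divided_difference ij (schubert_is_gkm sf)).
- move=> p; case: (eqVneq (g p) 0) => [->|gp]; first by rewrite msize0.
  have : (msize (xdiff (p i) (p j) * g p) <= (plength w).+1)%N.
    rewrite -fg (leq_trans (msizeD_le _ _)) // msizeN geq_max.
    by rewrite !(schubert_msize sf).
  by rewrite msizeM ?xdiff_eq0 // msize_xdiff // lw.
- move=> p lp npu; apply/eqP; apply: contraT => /g_f/orP[]/negP[]; apply/eqP.
    apply: (schubert_small sf); first by rewrite lw; lia.
    by apply: contraTneq lp => ->; rewrite lw -ltnNge.
  apply: (schubert_small sf); first by rewrite lw (leq_trans (plength_adjacent_le _ ij)).
  by apply: contra npu => /eqP e; rewrite -(rmul_tpermK p (i, j)) e rmul_tpermK.
- have := fg u; rewrite -/w (schubert_small sf (p := u)) ?lw //; last first.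
    by apply/eqP => e; have := congr1 (@plength n) e; rewrite lw; lia.
  rewrite subr0 (schubert_self sf) /w Inv_adjacent // big_setU1 /=; last first.
    by rewrite mem_Inv !permK; lia.
  by move/mulfI->; rewrite // xdiff_eq0.
move=> p /g_f/orP[]/(schubert_dominated sf).
  exact: dominated_rmul.
exact: dominated_rmul2.
Qed.

Lemma no_ascent_decreasing u :
    (forall i j, j = i.+1 :> nat -> (u j < u i)%N) ->
  forall i j, (i < j)%N -> (u j < u i)%N.
Proof.
move=> desc i j; have [m] := ubnP (j - i)%N; elim: m i j => // m IHm i j jim ij.
case: (eqVneq (j : nat) i.+1) => [/desc //|nij].
have pj : (j.-1 < n)%N by have := ltn_ord j; lia.
apply: ltn_trans (desc (Ordinal pj) j _) (IHm i (Ordinal pj) _ _) => /=; lia.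
Qed.

(** All pairs are inversions of the longest element, so its class is supported at
    one point. *)
Lemma schubert_longest u : (forall i j, (i < j)%N -> (u j < u i)%N) ->
  schubert u (fun p => if p == u then \prod_(ab in Inv u) xdiff ab.1 ab.2 else 0).
Proof.
move=> desc; split.
- have prod0 p i j : (i < j)%N -> (p == u) || (rmul_tperm p (i, j) == u) ->
      identify (p i) (p j) (\prod_(ab in Inv u) xdiff ab.1 ab.2) = 0.
    move=> ij pu; have : ((p i, p j) \in Inv u) || ((p j, p i) \in Inv u).
      have uI : (u j, u i) \in Inv u by rewrite mem_Inv !permK desc.
      case/orP: pu => /eqP pu; first by rewrite pu uI orbT.
      by move: uI; rewrite -{1 2}pu !rmul_tpermE /= tpermL tpermR => ->.
    case/orP => inI; last apply: identifyC; apply/identify_eq0; 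
      by rewrite (bigD1 _ inI) /=; eexists.
  move=> p i j ij; case: ifP => [qu|_]; case: ifP => [pu|_] //.
  - by rewrite (prod0 _ _ _ ij) ?qu ?orbT // rmorph0.
  by rewrite (prod0 _ _ _ ij) ?pu // rmorph0.
- move=> p; case: ifP => _; last by rewrite msize0.
  by rewrite msize_prod_xdiff //; exact: Inv_lt.
- by move=> p _ /negPf->.
- by rewrite eqxx.
by move=> p; case: (p =P u) => [-> _ k a //|_]; rewrite eqxx.
Qed.

Lemma schubert_exists u : exists f, schubert u f.
Proof.
have [m] := ubnP (#|{: 'I_n * 'I_n}| - plength u)%N.
elim: m u => // m IHm u um.
case: (pickP [pred ij : 'I_n * 'I_n | (ij.2 == ij.1.+1 :> nat) && (u ij.1 < u ij.2)%N]).
  move=> [i j] /= /andP[/eqP ij lt_u].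
  suff [f sf] : exists f, schubert (rmul_tperm u (i, j)) f.
    exact: schubert_divided_difference sf.
  have : (plength (rmul_tperm u (i, j)) <= #|{: 'I_n * 'I_n}|)%N by exact: max_card.
  by move=> le_w; apply: IHm; move: um le_w; rewrite plength_adjacent //; lia.
move=> no_asc; eexists; apply: schubert_longest; apply: no_ascent_decreasing => i j ij.
have := no_asc (i, j); rewrite /= ij eqxx /= => /negbT; rewrite -leqNgt.
rewrite leq_eqVlt => /orP[/eqP/val_inj/perm_inj eij|//].
by move: ij; rewrite eij; lia.
Qed.

End Classes.

(** * The Chevalley formula *)

Section Chevalley.
Variable n : nat.
Implicit Types (u v p w : 'S_n) (i j k l : 'I_n).
Implicit Types (f g : 'S_n -> {mpoly rat[n]}).

Lemma tperm_lt_inj i j k l : (i < j)%N -> (k < l)%N ->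
  tperm i j = tperm k l -> (i, j) = (k, l).
Proof.
move=> ij kl e; have : tperm k l i = j by rewrite -e tpermL.
case: tpermP => [-> <- //|eil ekj|_ _ eij]; first by move: ij kl; rewrite eil ekj; lia.
by move: ij; rewrite eij ltnn.
Qed.

Lemma rmul_tperm_inj p i j k l : (i < j)%N -> (k < l)%N ->
  rmul_tperm p (i, j) = rmul_tperm p (k, l) -> (i, j) = (k, l).
Proof. by move=> ij kl /mulIg; exact: tperm_lt_inj. Qed.

(** By the congruences, f p agrees modulo every inversion of [p] with the product over
    the inversions other than the reflected one: both vanish modulo the others, and
    modulo the reflected one [cover_prod_Inv] applies. The difference has degree
    l(u) < l(p), hence is zero. *)
Lemma schubert_cover u f i j : schubert u f -> (i < j)%N ->
    plength (rmul_tperm u (i, j)) = (plength u).+1 ->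
  \prod_(ab in Inv (rmul_tperm u (i, j))) xdiff ab.1 ab.2
  = xdiff (u i) (u j) * f (rmul_tperm u (i, j)).
Proof.
move=> sf ij cov; set p := rmul_tperm u (i, j).
have lt_u := cover_lt ij cov.
have pI : (u i, u j) \in Inv p by exact: reflection_in_Inv.
rewrite (big_setD1 _ pI) /=; congr (_ * _); apply/esym/eqP.
rewrite -subr_eq0; apply/eqP.
apply: (@prod_xdiff_dvd_eq0 _ (Inv p)) => [ab|[a b] abI|]; first exact: Inv_lt.
  rewrite rmorphB /=; case: (eqVneq (a, b) (u i, u j)) => [[-> ->]|ne_ab].
    by rewrite cover_prod_Inv // -(schubert_self sf) (schubert_is_gkm sf) // subrr.
  rewrite (big_setD1 (a, b)) /=; last by rewrite in_setD1 ne_ab.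
  rewrite rmorphM /= identify_xdiff_self mul0r subr0.
  apply: (gkm_Inv (schubert_is_gkm sf) abI); apply: (schubert_small sf).
    by have := plength_rmul_Inv abI; rewrite cov ltnS.
  move: abI; rewrite mem_Inv => /andP[ab ba]; apply: contra ne_ab => /eqP e.
  have /(rmul_tperm_inj ba ij) [ei ej] :
    rmul_tperm p ((p^-1)%g b, (p^-1)%g a) = rmul_tperm p (i, j) by rewrite e rmul_tpermK.
  rewrite -[a](permKV p) -[b](permKV p) ei ej !rmul_tpermE /=.
  by rewrite tpermL tpermR.
rewrite (leq_trans (msizeD_le _ _)) // msizeN geq_max -/(plength p) cov.
rewrite (schubert_msize sf) msize_prod_xdiff; last first.
  by move=> ab; rewrite in_setD1 => /andP[_ /Inv_lt].
by have := cardsD1 (u i, u j) (Inv p); rewrite pI -/(plength p) cov add1n => -[<-]; rewrite !leqnn.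
Qed.

(** If no reflection joins [p] to [u], all lower neighbours of [p] have value 0, so f p
    is divisible by l(p) coprime factors. *)
Lemma schubert_noncover u f p : schubert u f -> plength p = (plength u).+1 ->
  f p != 0 -> exists ij : 'I_n * 'I_n, (ij.1 < ij.2)%N /\ p = rmul_tperm u ij.
Proof.
move=> sf lp fp0.
case: (pickP [pred ij : 'I_n * 'I_n | (ij.1 < ij.2)%N && (p == rmul_tperm u ij)]).
  by move=> ij /andP[lt_ij /eqP ep]; exists ij.
move=> no_ij; case/negP: fp0; apply/eqP.
apply: (@prod_xdiff_dvd_eq0 _ (Inv p)) => [ab|[a b] abI|]; first exact: Inv_lt.
  apply: (gkm_Inv (schubert_is_gkm sf) abI); apply: (schubert_small sf).
    by have := plength_rmul_Inv abI; rewrite lp ltnS.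
  apply/eqP => e; move: abI; rewrite mem_Inv => /andP[ab ba].
  have := no_ij ((p^-1)%g b, (p^-1)%g a).
  by rewrite /= ba -{1}e rmul_tpermK eqxx.
by rewrite -/(plength p) lp (schubert_msize sf).
Qed.

(** When k is not the last index, weight k 1 - weight k p is the restriction at [p] of
    the Schubert divisor class of the adjacent transposition of k and k + 1. *)
Definition weight (k : 'I_n) p : {mpoly rat[n]} := \sum_(i < n | (i <= k)%N) 'X_(p i).

Lemma weight_rmul k p i j : (i < j)%N ->
  weight k p - weight k (rmul_tperm p (i, j))
  = if (i <= k < j)%N then xdiff (p i) (p j) else 0.
Proof.
move=> ij; rewrite /weight; case: ifP => [/andP[ik kj]|ikj].
  rewrite (bigD1 i) //= [X in _ - X](bigD1 i) //= rmul_tpermE tpermL.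
  rewrite [X in _ - (_ + X)](eq_bigr (fun m => 'X_(p m))) => [|m /andP[mk mi]].
    by rewrite /xdiff; ring.
  rewrite rmul_tpermE /= tpermD // eq_sym //.
  by rewrite -val_eqE ltn_eqF //; apply: leq_ltn_trans kj.
apply/eqP; rewrite subr_eq0; apply/eqP.
rewrite (reindex_inj (@perm_inj _ (tperm i j))) /=.
apply: eq_big => [m|m _]; last by rewrite rmul_tpermE.
by case: tpermP => [->|->|//]; move: ikj ij; lia.
Qed.

Lemma msize_weightB k u p : (msize (weight k u - weight k p) <= 2)%N.
Proof.
have szD (f g : {mpoly rat[n]}) : (msize f <= 2 -> msize g <= 2 -> msize (f + g) <= 2)%N.
  by move=> szf szg; rewrite (leq_trans (msizeD_le _ _)) // geq_max szf szg.
have szw q : (msize (weight k q) <= 2)%N.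
  apply: (big_ind (fun f : {mpoly rat[n]} => msize f <= 2)%N) => [||i _].
  - by rewrite msize0.
  - exact: szD.
  by rewrite msizeX mdeg1.
by apply: szD; rewrite ?msizeN.
Qed.

Lemma identify_weight k p i j :
  identify (p i) (p j) (weight k (rmul_tperm p (i, j)))
  = identify (p i) (p j) (weight k p).
Proof.
rewrite !rmorph_sum; apply: eq_bigr => m _ /=.
by rewrite rmul_tpermE (inj_tperm _ _ _ (@perm_inj _ p)) identify_tperm.
Qed.

Definition chevalley_covers (k : 'I_n) u : pred ('I_n * 'I_n) :=
  fun ij => (ij.1 <= k < ij.2)%N && (plength (rmul_tperm u ij) == (plength u).+1).

(** Both sides satisfy the congruences in degree l(u) + 1 and agree at lengths at most
    l(u) + 1, where each class on the right has only its diagonal value. *)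
Lemma chevalley (tau : 'S_n -> 'S_n -> {mpoly rat[n]}) u v k :
    (forall w, schubert w (tau w)) ->
  (weight k u - weight k v) * tau u v
  = \sum_(ij | chevalley_covers k u ij) tau (rmul_tperm u ij) v.
Proof.
move=> st; apply/eqP; rewrite -subr_eq0; apply/eqP; move: v.
apply: (@gkm_vanish _ _ (plength u).+1) => [p i j ij|p|p lp].
- rewrite !rmorphB !rmorphM !rmorphB /= identify_weight (schubert_is_gkm (st u)) //.
  congr (_ - _); rewrite !rmorph_sum; apply: eq_bigr => w _.
  by rewrite /= (schubert_is_gkm (st _)).
- rewrite (leq_trans (msizeD_le _ _)) // msizeN geq_max; apply/andP; split.
    case: (eqVneq (weight k u - weight k p) 0) => [->|w0]; first by rewrite mul0r msize0.
    case: (eqVneq (tau u p) 0) => [->|t0]; first by rewrite mulr0 msize0.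
    rewrite msizeM // -subn1 leq_subLR.
    exact: leq_add (msize_weightB k u p) (schubert_msize (st u) p).
  apply: (big_ind (fun f : {mpoly rat[n]} => msize f <= (plength u).+2)%N)
    => [|f g szf szg|ij /andP[_ /eqP <-]]; first by rewrite msize0.
    by rewrite (leq_trans (msizeD_le _ _)) // geq_max szf szg.
  exact: (schubert_msize (st _)).
have small0 (P : pred ('I_n * 'I_n)) : (forall ij, P ij -> chevalley_covers k u ij) ->
    (forall ij, P ij -> p != rmul_tperm u ij) -> \sum_(ij | P ij) tau (rmul_tperm u ij) p = 0.
  move=> Pc Pp; rewrite big1 // => ij Pij; apply: (schubert_small (st _)) (Pp _ Pij).
  by case/andP: (Pc _ Pij) => _ /eqP->.
have [-> |npu] := eqVneq p u.
  rewrite subrr mul0r big1 ?subrr // => ij /andP[_ /eqP lu].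
  apply: (schubert_small (st _)); first by rewrite lu.
  by apply/eqP => e; move: lu; rewrite -e; lia.
have [tp0|tpn0] := eqVneq (tau u p) 0.
  rewrite tp0 mulr0 sub0r small0 ?oppr0 // => -[i j] ijc.
  apply/eqP => ep; case/andP: ijc => /= /andP[ik kj] /eqP cov.
  have := schubert_cover (st u) (leq_ltn_trans ik kj) cov.
  rewrite -ep tp0 mulr0 => /eqP; apply/negP; apply: prod_xdiff_neq0; exact: Inv_lt.
have pu : plength p = (plength u).+1.
  apply/eqP; rewrite eqn_leq lp ltnNge; apply: contra tpn0 => lpu.
  by rewrite (schubert_small (st u)).
have [[i j] /= [ij ep]] := schubert_noncover (st u) pu tpn0.
rewrite {1}ep weight_rmul //; have cov := pu; rewrite ep in cov.
have uniq_ij kl : chevalley_covers k u kl -> p = rmul_tperm u kl -> kl = (i, j).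
  case: kl => k' l /andP[/= /andP[kk kl] _]; rewrite ep => /esym.
  by apply: rmul_tperm_inj => //; exact: leq_ltn_trans kl.
case: ifP => ikj.
  rewrite (bigD1 (i, j)) /=; last by rewrite /chevalley_covers /= ikj cov eqxx.
  rewrite small0 => [|kl /andP[]//|kl /andP[klc]]; last first.
    by apply: contra => /eqP /(uniq_ij _ klc)->.
  rewrite addr0 {1}ep -schubert_cover // -ep (schubert_self (st p)) subrr //.
rewrite mul0r small0 ?subrr // => kl klc; apply/eqP => /(uniq_ij _ klc) e.
by move: klc; rewrite e /chevalley_covers /= ikj.
Qed.

(** Among the covers u(i, j) with i <= k < j only those with i = k contribute at
    [v]: the others exceed [v] at their first difference. *)
Lemma first_difference_recursion (tau : 'S_n -> 'S_n -> {mpoly rat[n]}) u v k :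
    (forall w, schubert w (tau w)) ->
    (forall m : 'I_n, (m < k)%N -> u m = v m) ->
  xdiff (u k) (v k) * tau u v
  = \sum_(j : 'I_n | (k < j)%N && (plength (rmul_tperm u (k, j)) == (plength u).+1))
      tau (rmul_tperm u (k, j)) v.
Proof.
move=> st uv; have := chevalley u v k st.
have -> : weight k u - weight k v = xdiff (u k) (v k).
  rewrite /weight (bigD1 k) //= [X in _ - X](bigD1 k) //=.
  rewrite [X in _ - (_ + X)](eq_bigr (fun m => 'X_(u m))) => [|m /andP[mk nmk]].
    by rewrite /xdiff; ring.
  by rewrite uv // ltn_neqAle nmk.
move=> ->; rewrite (bigID (fun ij => ij.1 == k)) /= addrC big1 ?add0r; last first.
  move=> [i j] /= /andP[/andP[/= /andP[ik kj] /eqP cov] nik].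
  have lt_ik : (i < k)%N by rewrite ltn_neqAle nik.
  apply/eqP; apply: contraT => /(schubert_dominated (st _)) dom.
  have lt_u := cover_lt (ltn_trans lt_ik kj) cov.
  have : (rmul_tperm u (i, j) i <= v i)%N.
    apply: dominated_first_diff dom _ => m mi; rewrite rmul_tpermE /= tpermD.
    - by rewrite uv // (ltn_trans mi).
    - by rewrite -val_eqE gtn_eqF.
    by rewrite -val_eqE gtn_eqF //; exact: ltn_trans mi (ltn_trans lt_ik kj).
  by rewrite rmul_tpermE /= tpermL -uv // leqNgt lt_u.
rewrite (reindex_onto (fun j => (k, j)) snd) /=; last by move=> [i j] /= /andP[_ /eqP->].
by apply: eq_bigl => j; rewrite /chevalley_covers /= leqnn !eqxx !andbT.
Qed.

End Chevalley.

(** * Chains with increasing labels *)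

Section Chains.
Variable n : nat.
Implicit Types (u v p w : 'S_n) (i j k l : 'I_n) (ij : 'I_n * 'I_n).
Implicit Types (s : seq ('I_n * 'I_n)).

Definition cover_label u ij :=
  [&& (ij.1 < ij.2)%N, (u ij.1 < u ij.2)%N
    & plength (rmul_tperm u ij) == (plength u).+1].

(** Recursive forms of the conditions on chains, suited to removing the first step. *)
Fixpoint is_chain u v s : bool :=
  if s is ij :: s' then cover_label u ij && is_chain (rmul_tperm u ij) v s'
  else u == v.

Definition label_sorted s := sorted leq [seq val ij.1 | ij <- s].

Fixpoint removed u v s : seq ('I_n * 'I_n) :=
  if s is ij :: s' then (u ij.1, v ij.1) :: removed (rmul_tperm u ij) v s' else [::].

Definition chain_prod u v s : {mpoly rat[n]} :=
  \prod_(ab in Inv v | ab \notin removed u v s) xdiff ab.1 ab.2.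

Definition chain_sum m u v : {mpoly rat[n]} :=
  \sum_(g : m.-tuple ('I_n * 'I_n) | is_chain u v g && label_sorted g)
    chain_prod u v g.

Lemma chain_vertexS x0 u s m : (m < size s)%N ->
  chain_vertex u s m.+1 = rmul_tperm (chain_vertex u s m) (nth x0 s m).
Proof. by move=> ms; rewrite /chain_vertex (take_nth x0) // foldl_rcons. Qed.

Lemma is_chainE x0 u v s :
  is_chain u v s =
    all (fun m => cover_label (chain_vertex u s m) (nth x0 s m)) (iota 0 (size s))
    && (chain_vertex u s (size s) == v).
Proof.
elim: s u => [|ij s IHs] u //=; rewrite IHs -andbA; congr [&& _, _ & _].
by rewrite (iotaDl 1) all_map.
Qed.

Lemma removedE x0 u v s :
  removed u v s =
    [seq (chain_vertex u s m (nth x0 s m).1, v (nth x0 s m).1) | m <- iota 0 (size s)].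
Proof.
elim: s u => [|ij s IHs] u //=; rewrite IHs; congr (_ :: _).
by rewrite (iotaDl 1) -map_comp.
Qed.

Lemma mem_C0 u v (g : (nsteps u v).-tuple ('I_n * 'I_n)) :
  (g \in C0 u v) = is_chain u v g && label_sorted g.
Proof.
rewrite inE andbA; congr (_ && _); move: (nsteps u v) g => m g.
case: m g => [|m] g; first by rewrite tuple0 /= andbC; case: eqP => //= _; apply/forallP => -[].
rewrite (is_chainE (thead g)) size_tuple; congr (_ && _).
apply/forallP/allP => [all_k k|all_k k].
  rewrite mem_iota /= => km; have := all_k (Ordinal km).
  rewrite (tnth_nth (thead g)) /= (chain_vertexS (thead g)) ?size_tuple //.
  by rewrite /cover_label; case: (nth _ g k).
have := all_k k; rewrite mem_iota /= => /(_ (ltn_ord k)).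
rewrite (tnth_nth (thead g)) /= (chain_vertexS (thead g)) ?size_tuple //.
by rewrite /cover_label; case: (nth _ g k).
Qed.

Lemma E_chain_prod u v (g : (nsteps u v).-tuple ('I_n * 'I_n)) : E g = chain_prod u v g.
Proof.
rewrite /E /chain_prod /Inv_chain; apply: eq_bigl => ab; rewrite in_setD andbC.
congr (_ && ~~ _); move: (nsteps u v) g => m g.
case: m g => [|m] g.
  by rewrite tuple0 /= in_nil; apply/imsetP => -[[]].
have x0 := thead g.
rewrite (removedE x0) size_tuple; apply/imsetP/mapP => [[k _ ->]|[k]].
  by exists (val k); rewrite ?mem_iota ?ltn_ord //= (tnth_nth x0).
rewrite mem_iota /= => km ->; exists (Ordinal km) => //.
by rewrite (tnth_nth x0).
Qed.

Lemma rmul_tperm_below u i j (m : 'I_n) : (m < i)%N -> (i < j)%N -> rmul_tperm u (i, j) m = u m.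
Proof.
move=> mi ij; rewrite rmul_tpermE /= tpermD // -val_eqE gtn_eqF //.
exact: ltn_trans ij.
Qed.

Lemma rmul_tperm_incr u i j k : (i < j)%N -> (u i < u j)%N -> (k <= i)%N ->
  (u k <= rmul_tperm u (i, j) k)%N.
Proof.
move=> ij lt_u; rewrite leq_eqVlt => /orP[/eqP/val_inj->|ki].
  by rewrite rmul_tpermE tpermL ltnW.
by rewrite rmul_tperm_below.
Qed.

Definition labels_ge (k : nat) s := all (fun ij => (k <= ij.1)%N) s.

Lemma chain_fixes_below u v s (k : nat) (m : 'I_n) : is_chain u v s -> labels_ge k s ->
  (m < k)%N -> u m = v m.
Proof.
move=> + + mk; elim: s u => [|[i j] s IHs] u /=; first by move/eqP->.
case/andP => /and3P[/= ij _ _] /IHs{}IHs /andP[ki /IHs].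
by rewrite rmul_tperm_below //; apply: leq_trans ki.
Qed.

Lemma chain_incr u v s k : is_chain u v s -> labels_ge k s -> (u k <= v k)%N.
Proof.
elim: s u => [|[i j] s IHs] u /=; first by move/eqP->.
case/andP => /and3P[/= ij lt_u _] /IHs{}IHs /andP[ki /IHs].
by apply: leq_trans; apply: rmul_tperm_incr.
Qed.

Lemma removed_ge u v s k x : is_chain u v s -> labels_ge k s ->
  (x, v k) \in removed u v s -> (u k <= x)%N.
Proof.
elim: s u => [|[i j] s IHs] u //=.
case/andP => /and3P[/= ij lt_u _] /IHs{}IHs /andP[ki /IHs{}IHs].
rewrite inE xpair_eqE => /orP[/andP[/eqP-> /eqP/perm_inj->] //|/IHs].
by apply: leq_trans; apply: rmul_tperm_incr.
Qed.

Lemma label_sorted_cons ij s :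
  label_sorted (ij :: s) = labels_ge ij.1 s && label_sorted s.
Proof. by rewrite /label_sorted /= (path_sortedE leq_trans) all_map. Qed.

(** A label below [k] would raise a value that [u] and [v] share, for good. *)
Lemma chain_labels_ge u v s k : is_chain u v s -> label_sorted s ->
  (forall l, (l < k)%N -> u l = v l) -> labels_ge k s.
Proof.
case: s => [|[i j] s] //= /andP[/and3P[/= ij lt_u _] ch]; rewrite label_sorted_cons /=.
case/andP=> ge_i _ uv; have ki : (k <= i)%N.
  rewrite leqNgt; apply/negP => ik; have := chain_incr ch ge_i.
  by rewrite rmul_tpermE /= tpermL -(uv i ik) leqNgt lt_u.
by rewrite ki; apply: sub_all ge_i => x; exact: leq_trans.
Qed.

(** If the first label exceeded [k], the value at k would never change. *)
Lemma chain_first_label u v ij s k : is_chain u v (ij :: s) -> label_sorted (ij :: s) ->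
  (forall l, (l < k)%N -> u l = v l) -> u k != v k -> ij.1 = k.
Proof.
move=> ch srt uv ukv; have /= /andP[ki _] := chain_labels_ge ch srt uv.
apply/val_inj/eqP; rewrite eqn_leq ki andbT leqNgt; apply: contra ukv => lt_k.
apply/eqP; apply: (chain_fixes_below ch _ lt_k); rewrite /= leqnn.
by move: srt; rewrite label_sorted_cons => /andP[].
Qed.

(** The pair removed by the first step is an inversion of [v], since the value u k
    cannot occur in [v] before position k, and no later step removes it again, since
    the value at k has increased. *)
Lemma chain_prod_cons u v k j s : is_chain u v ((k, j) :: s) ->
    labels_ge k s -> (forall l, (l < k)%N -> u l = v l) ->
  chain_prod (rmul_tperm u (k, j)) v s
  = xdiff (u k) (v k) * chain_prod u v ((k, j) :: s).
Proof.
move=> /= /andP[/and3P[/= kj lt_u _] ch] ge_k uv.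
have uk_lt : (u k < rmul_tperm u (k, j) k)%N by rewrite rmul_tpermE tpermL.
have lt_uv : (u k < v k)%N := leq_trans uk_lt (chain_incr ch ge_k).
have inI : (u k, v k) \in Inv v.
  rewrite mem_Inv lt_uv permK /= ltnNge leq_eqVlt; apply/negP.
  case/orP => [/eqP/val_inj ek|lt_k].
    by move: lt_uv; rewrite -{2}ek permKV ltnn.
  have := uv _ lt_k; rewrite permKV => /perm_inj ek.
  by move: lt_k; rewrite ek ltnn.
rewrite /chain_prod (bigD1 (u k, v k)) /=; last first.
  by rewrite inI; apply/negP => /(removed_ge ch ge_k); rewrite leqNgt uk_lt.
by congr (_ * _); apply: eq_bigl => ab; rewrite inE negb_or -andbA [X in _ && X]andbC.
Qed.

Lemma big_tuple_cons (T : finType) m (P : pred (seq T)) (F : seq T -> {mpoly rat[n]}) :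
  \sum_(t : m.+1.-tuple T | P t) F t
  = \sum_(x : T) \sum_(t : m.-tuple T | P (x :: t)) F (x :: t).
Proof.
rewrite pair_big_dep /=.
rewrite (reindex (fun xt : T * m.-tuple T => [tuple of xt.1 :: xt.2])) //=.
exists (fun t => (thead t, [tuple of behead t])) => [[x t] _|t _].
  by congr (_, _); apply: val_inj.
by rewrite /= -tuple_eta.
Qed.

Lemma chain_sumS (m : nat) u v k : (forall l, (l < k)%N -> u l = v l) -> u k != v k ->
  \sum_(j : 'I_n | (k < j)%N && (plength (rmul_tperm u (k, j)) == (plength u).+1))
     chain_sum m (rmul_tperm u (k, j)) v
  = xdiff (u k) (v k) * chain_sum m.+1 u v.
Proof.
move=> uv ukv; rewrite /chain_sum.
rewrite (big_tuple_cons _ (fun s => is_chain u v s && label_sorted s)).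
rewrite [X in _ * X](bigID (fun ij => ij.1 == k)) /=.
rewrite [X in _ * X]addrC [X in _ * (X + _)]big1 ?add0r; last first.
  move=> ij nik; rewrite big_pred0 // => g; apply/negP => /andP[ch srt].
  by case/eqP: nik; apply: chain_first_label ch srt uv ukv.
rewrite (reindex_onto (fun j => (k, j)) snd) /=; last by move=> [i j] /= /eqP->.
rewrite big_distrr big_mkcond /= [RHS]big_mkcond /=; apply: eq_bigr => j _.
rewrite !eqxx /=; case: ifP => cov; last first.
  rewrite big_pred0 ?mulr0 // => g; apply/negP => /andP[/andP[/and3P[/= kj _ lu] _] _].
  by rewrite kj lu in cov.
case/andP: cov => kj cov; have lt_u := cover_lt kj (eqP cov).
have covl : cover_label u (k, j) by rewrite /cover_label /= kj lt_u cov.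
have uv' (l : 'I_n) : (l < k)%N -> rmul_tperm u (k, j) l = v l.
  by move=> lk; rewrite rmul_tperm_below // uv.
rewrite big_distrr /=; apply: eq_big => [g|g /andP[ch srt]].
  rewrite covl label_sorted_cons /=; case ch: (is_chain _ _ _) => //=.
  by case srt: (label_sorted _); rewrite ?andbF // (chain_labels_ge ch srt uv').
by apply: chain_prod_cons; rewrite /= ?covl // (chain_labels_ge ch srt uv').
Qed.

End Chains.

(** * The restriction formula *)

Section Restriction.
Variable n : nat.
Implicit Types (u v p : 'S_n).

Lemma bruhat_plength u p : bruhat u p -> u = p \/ (plength u < plength p)%N.
Proof.
case/connectP => s; elim: s u => [|w s IHs] u /=; first by move=> _ ->; left.
case/andP=> /existsP[ij /andP[_ lt_uw]] /IHs{}IHs /IHs[<-|]; right => //.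
exact: ltn_trans lt_uw _.
Qed.

Lemma dhomog_msize_le d (f : {mpoly rat[n]}) : f \is d.-homog -> (msize f <= d.+1)%N.
Proof.
by move/dhomogP => hf; rewrite msizeE; apply/bigmax_leqP_seq => m /hf ->.
Qed.

Lemma equivariant_schubert_class_eq u tau f :
  equivariant_schubert_class u tau -> schubert u f -> tau =1 f.
Proof.
move=> [_ gkm_tau hom_tau supp_tau diag_tau] sf p; apply/eqP.
rewrite -subr_eq0; apply/eqP.
apply: (@gkm_vanish _ (fun p => tau p - f p) (plength u)) => [q i j ij|q|q qu].
- rewrite !rmorphB /= (schubert_is_gkm sf) //; congr (_ - _).
  apply/eqP; rewrite -subr_eq0 -rmorphB /=; apply/eqP/identify_eq0.
  by have [g _ ->] := gkm_tau q i j ij; exists g.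
- rewrite (leq_trans (msizeD_le _ _)) // msizeN geq_max.
  by rewrite dhomog_msize_le // (schubert_msize sf).
case: (eqVneq q u) => [->|nqu]; first by rewrite diag_tau (schubert_self sf) subrr.
rewrite (schubert_small sf) // subr0; apply: supp_tau; apply/negP.
case/bruhat_plength => [e|]; first by rewrite e eqxx in nqu.
by rewrite ltnNge qu.
Qed.

Lemma chain_sum0 u v : chain_sum 0 u v = if u == v then chain_prod v v [::] else 0.
Proof.
rewrite /chain_sum; case: eqVneq => [->|nuv]; last first.
  by rewrite big_pred0 // => g; rewrite tuple0 /= (negPf nuv).
rewrite (big_pred1 [tuple]) // => g.
by rewrite tuple0 /= !eqxx.
Qed.

Lemma schubert_chain_sum (tau : 'S_n -> 'S_n -> {mpoly rat[n]}) m u v :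
    (forall w, schubert w (tau w)) -> plength v = (plength u + m)%N ->
  tau u v = chain_sum m u v.
Proof.
move=> st; elim: m u => [|m IHm] u; rewrite ?addn0 ?addnS => lv.
  rewrite chain_sum0; case: eqVneq => [->|nuv].
    by rewrite (schubert_self (st v)); apply: eq_bigl => ab; rewrite andbT.
  by rewrite (schubert_small (st u)) ?lv // eq_sym.
have [k [ukv uv]] : exists k : 'I_n, u k != v k /\
    forall l : 'I_n, (l < k)%N -> u l = v l.
  have [k0 /= uk0] : exists k0 : 'I_n, u k0 != v k0.
    apply/existsP; apply: contraT; rewrite negb_exists => /forallP uv.
    suff e : u = v by move: lv; rewrite e; lia.
    by apply/permP => l; apply/eqP; have := uv l; rewrite negbK.
  case: (@arg_minnP _ k0 (fun k => u k != v k) (fun k => k : nat) uk0) => k uk kmin.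
  exists k; split => // l lk; apply/eqP; apply: contraTT lk => ul.
  by rewrite -leqNgt kmin.
have /mulfI : xdiff (u k) (v k) != 0 by rewrite xdiff_eq0.
apply; rewrite (first_difference_recursion st uv) -chain_sumS //.
apply: eq_bigr => j /andP[_ /eqP lu]; apply: IHm.
by rewrite lu addSn.
Qed.

End Restriction.

Theorem theorem7p2 (n : nat) (u v : 'S_n) (tau : 'S_n -> {mpoly rat[n]}) :
  equivariant_schubert_class u tau ->
  tau v = \sum_(g in C0 u v) E g /\
  \sum_(g in C0 u v) E g =
    \sum_(g in C0 u v) \prod_(ab in Inv_chain g) ('X_(ab.1) - 'X_(ab.2)).
Proof.
move=> tau_class; split=> //.
have [sigma st] := fin_all_exists (@schubert_exists n).
rewrite (equivariant_schubert_class_eq tau_class (st u)).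
transitivity (chain_sum (nsteps u v) u v); last first.
  by apply: eq_big => g; rewrite ?mem_C0 // => _; rewrite E_chain_prod.
have [le_uv|lt_vu] := leqP (plength u) (plength v).
  by apply: schubert_chain_sum st _; rewrite /nsteps subnKC.
(* With l(v) < l(u) no step is left, and the empty chain does not join u to v. *)
have nuv : u != v by apply: contraTneq lt_vu => ->; rewrite ltnn.
rewrite /nsteps (eqP (ltnW lt_vu)) chain_sum0 (negPf nuv).
by rewrite (schubert_small (st u)) ?(ltnW lt_vu) // eq_sym.
Qed.
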